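(* Let $0<p<1$ be fixed, put $q=1-p$, and let $\log$ denote the logarithm with base $1/q$. Let $\mathbf{G}$ be a random graph on $n$ labelled vertices whose edges are chosen independently, each with probability $p$. Then, with probability tending to $1$ as $n\to\infty$, all of the following hold: $$ \gamma_r(\mathbf{G})=\gamma(\mathbf{G}),\qquad \gamma_{\mathrm{tr}}(\mathbf{G})=\gamma_t(\mathbf{G}), $$ and $$ \gamma_r(\mathbf{G})=\lfloor\log n-2\log\log n+\log\log e\rfloor+\epsilon,\qquad\text{where }\epsilon=1\text{ or }\epsilon=2 . $$
   Context: All graphs are finite and undirected, without loops or multiple edges; $e$ is the base of the natural logarithm. A set $X\subseteq V(G)$ is a dominating set of $G$ if every vertex not in $X$ is adjacent to a vertex in $X$; $\gamma(G)$ is the minimum cardinality of a dominating set. A dominating set $X$ is a total dominating set if every vertex of $X$ is adjacent to a vertex of $X$; $\gamma_t(G)$ is the minimum cardinality of a total dominating set. A dominating set $X$ is a restrained dominating set if every vertex in $V(G)-X$ is adjacent to a vertex in $V(G)-X$; $\gamma_r(G)$ is the minimum cardinality of a restrained dominating set. A restrained dominating set $X$ is a total restrained dominating set if, in addition, every vertex of $X$ is adjacent to a vertex of $X$; $\gamma_{\mathrm{tr}}(G)$ is the minimum cardinality of a total restrained dominating set. The value $\epsilon\in\{1,2\}$ may depend on the graph. *)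

(* Defs.v *)
From HB Require Import structures.
From mathcomp Require Import all_boot all_order all_algebra.
From mathcomp Require Import all_classical all_reals all_analysis.

Set Implicit Arguments.
Unset Strict Implicit.
Unset Printing Implicit Defensive.

Import Order.TTheory GRing.Theory Num.Theory.

Section Graphs.
Variable T : finType.

Definition vpairs : {set {set T}} := [set e : {set T} | #|e| == 2].

Record sgraph := SGraph {
  edges : {set {set T}};
  edges_vpairs : edges \subset vpairs }.

HB.instance Definition _ := [isSub for edges].
HB.instance Definition _ := [Finite of sgraph by <:].

(* Irreflexive: [set u; u] is a singleton, hence never an edge. *)
Definition adj (G : sgraph) (u v : T) : bool := [set u; v] \in edges G.

Definition dominating (G : sgraph) (X : {set T}) : bool :=
  [forall u in ~: X, exists v in X, adj G u v].

Definition total_dominating (G : sgraph) (X : {set T}) : bool :=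
  dominating G X && [forall u in X, exists v in X, adj G u v].

Definition restrained_dominating (G : sgraph) (X : {set T}) : bool :=
  dominating G X && [forall u in ~: X, exists v in ~: X, adj G u v].

Definition total_restrained_dominating (G : sgraph) (X : {set T}) : bool :=
  restrained_dominating G X && [forall u in X, exists v in X, adj G u v].

(* The default #|T| never undercuts the cardinality of a set satisfying P, so
   this is the minimum as soon as some set satisfies P; it is a junk value
   otherwise. *)
Definition min_card (P : pred {set T}) : nat :=
  \big[minn/#|T|]_(X : {set T} | P X) #|X|.

(* setT is always (restrained) dominating. A graph with an isolated vertex has
   no total (restrained) dominating set, and then gamma_t and gamma_tr are
   undefined mathematically. *)
Definition gamma (G : sgraph) : nat := min_card (dominating G).
Definition gamma_t (G : sgraph) : nat := min_card (total_dominating G).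
Definition gamma_r (G : sgraph) : nat := min_card (restrained_dominating G).
Definition gamma_tr (G : sgraph) : nat :=
  min_card (total_restrained_dominating G).

End Graphs.

Local Open Scope ring_scope.

(* The law of the random graph on T: the product over all pairs of vertices of
   Bernoulli(p) weights, i.e. edges are present independently, each with
   probability p. *)
Definition gnp_weight (R : realType) (T : finType) (p : R) (G : sgraph T) : R :=
  \prod_(e in vpairs T) (if e \in edges G then p else 1 - p).

Definition gnp_prob (R : realType) (n : nat) (p : R)
    (A : pred (sgraph 'I_n)) : R :=
  \sum_(G : sgraph 'I_n | A G) gnp_weight p G.

Definition logb (R : realType) (b x : R) : R := ln x / ln b.

(* Main.v *)
(* With u = ln n, lambda = ln (1/q), L = u / lambda, the threshold is
   t = (u - 2 ln u + ln lambda) / lambda, so that n q^t = u L. Put M = floor t.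
   A fixed k-set dominates with probability (1 - q^k)^(n-k). At k = M a first
   moment bound excludes dominating sets, since log E <= u t - u L -> -oo. At
   k = M + 2 > t + 1 the expected number is exp(c u L), and Chebyshev works with
   only two ranges of overlap: pairs meeting in fewer than r points, r being
   about s L with q < s < 1, have correlation 1 + o(1), while the others are rare
   enough to be bounded by the probability of a single domination. Hence
   gamma is M + 1 or M + 2 asymptotically almost surely.
   Moreover every vertex then has a neighbour outside any given set of at most
   2(M+2) vertices, so every dominating set of that size is restrained, and a
   minimum dominating set extends to a total dominating set of at most that size
   by adding one neighbour of each of its vertices. *)
Require Import Defs.
From HB Require Import structures.
From mathcomp Require Import all_boot all_order all_algebra.
From mathcomp Require Import all_classical all_reals all_analysis.
(* finset is imported again so that its lemmas shadow their homonyms on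
   classical sets. *)
From mathcomp Require Import finset zify ring lra.
Import Order.TTheory GRing.Theory Num.Theory.
Import numFieldNormedType.Exports.
Local Open Scope ring_scope.

(** * Deterministic reduction *)

Section MinCard.
Variable T : finType.
Implicit Types (P Q : pred {set T}) (X : {set T}).

Lemma min_card_leT P : (min_card P <= #|T|)%N.
Proof.
rewrite /min_card; elim/big_rec: _ => [//|X k _ hk].
by rewrite geq_min hk orbT.
Qed.

Lemma min_card_le P X : P X -> (min_card P <= #|X|)%N.
Proof.
move=> PX; rewrite /min_card; have := mem_index_enum X.
elim: (index_enum _) => //= Y r IHr; rewrite inE big_cons => /orP[/eqP <-|Xr].
  by rewrite PX geq_minl.
by case: (P Y); [rewrite geq_min IHr ?orbT | exact: IHr].
Qed.

(** The bound [k <= #|T|] covers the default value of the minimum. *)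
Lemma leq_min_card P k :
  (k <= #|T|)%N -> (forall X, P X -> k <= #|X|)%N -> (k <= min_card P)%N.
Proof.
move=> kT kP; rewrite /min_card; elim/big_rec: _ => [//|X j PX kj].
by rewrite leq_min kj kP.
Qed.

Lemma min_card_mono P Q : (forall X, P X -> Q X) ->
  (min_card Q <= min_card P)%N.
Proof.
move=> PQ; apply: leq_min_card => [|X /PQ]; first exact: min_card_leT.
exact: min_card_le.
Qed.

Lemma min_card_witness P X : P X -> exists2 Y, P Y & #|Y| = min_card P.
Proof.
move=> PX; have [Y PY Ymin] := arg_minnP (fun Z : {set T} => #|Z|) PX.
exists Y => //; apply/eqP; rewrite eqn_leq min_card_le // andbT.
by apply: leq_min_card => //; apply: max_card.
Qed.

(** Used to pass from sets of bounded size to sets of exact size, the ones that the union bounds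
    count. *)
Lemma superset_of_card X k : (#|X| <= k <= #|T|)%N ->
  exists2 Y : {set T}, X \subset Y & #|Y| = k.
Proof.
elim: k => [|k IHk] /andP[Xk kT].
  by exists X => //; apply/eqP; rewrite -leqn0.
have [<-|neXk] := eqVneq #|X| k.+1; first by exists X.
have [|Y XY Yk] := IHk.
  by rewrite -ltnS ltn_neqAle neXk Xk ltnW.
have /set0Pn[z zY] : ~: Y != set0.
  by rewrite -card_gt0 cardsCs setCK subn_gt0 Yk.
exists (z |: Y); first by rewrite (fintype.subset_trans XY) // subsetUr.
by rewrite cardsU1 -in_setC zY Yk.
Qed.
End MinCard.

Section Deterministic.
Variables (T : finType) (G : sgraph T).
Implicit Types X Y : {set T}.

Lemma adjC u v : adj G u v = adj G v u.
Proof. by rewrite /adj setUC. Qed.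

Lemma dominating_superset X Y :
  X \subset Y -> dominating G X -> dominating G Y.
Proof.
move=> XY /forall_inP dX; apply/forall_inP => u uY.
have uX : u \in ~: X by move: uY; apply: (fintype.subsetP _); rewrite setCS.
have /exists_inP[v vX uv] := dX u uX.
by apply/exists_inP; exists v => //; apply: (fintype.subsetP XY).
Qed.

(** Here [u] may lie in [X] or outside it; the case of empty [X] rules out isolated vertices. *)
Definition escapes (k : nat) : Prop :=
  forall X u, (#|X| <= k)%N -> [exists v in ~: X, adj G u v].

Lemma escapes_restrained k X : escapes k -> (#|X| <= k)%N ->
  dominating G X -> restrained_dominating G X.
Proof.
move=> ek Xk dX; rewrite /restrained_dominating dX.
by apply/forall_inP => u _; apply: ek.
Qed.

(* Adding one neighbour of each vertex of X makes the set total. *)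
Lemma total_dominating_double X : (forall u, [exists v, adj G u v]) ->
  dominating G X -> exists2 Y, total_dominating G Y & (#|Y| <= 2 * #|X|)%N.
Proof.
move=> nbr dX; have {}nbr u : exists v, adj G u v by apply/existsP.
pose g u := xchoose (nbr u).
have gP u : adj G u (g u) by apply: (xchooseP (nbr u)).
exists (X :|: g @: X); last first.
  rewrite mul2n -addnn (leq_trans (leq_card_setU _ _)) // leq_add2l.
  exact: leq_imset_card.
have dY := dominating_superset _ _ (subsetUl X (g @: X)) dX.
rewrite /total_dominating dY /=; apply/forall_inP => u uY.
apply/exists_inP; case: (boolP (u \in X)) => uX.
  by exists (g u) => //; rewrite inE imset_f ?orbT.
have /imsetP[w wX ->] : u \in g @: X by move: uY; rewrite inE (negPf uX).
by exists w; rewrite ?inE ?wX // adjC.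
Qed.

Lemma gamma_concentration M : (M <= #|T|)%N ->
    ~~ [exists X : {set T}, (#|X| == M) && dominating G X] ->
    [exists X : {set T}, (#|X| == M.+2) && dominating G X] ->
    escapes (2 * M.+2) ->
  [&& gamma_r G == gamma G,
      [exists X, total_dominating G X],
      [exists X, total_restrained_dominating G X],
      gamma_tr G == gamma_t G
    & (gamma_r G == M.+1) || (gamma_r G == M.+2)].
Proof.
move=> MT nodom /existsP[X0 /andP[/eqP X0k dX0]] esc.
have nbr u : [exists v, adj G u v].
  have : [exists v in ~: set0, adj G u v] by apply: esc; rewrite cards0.
  case/exists_inP => v _ uv.
  by apply/existsP; exists v.
have [Xd dXd cXd] := min_card_witness _ _ _ dX0.
have gamma_le : (gamma G <= M.+2)%N by rewrite -X0k; apply: min_card_le.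
have gamma_ge : (M < gamma G)%N.
  (* A dominating set of at most [M] vertices could be padded to exactly [M]. *)
  rewrite ltnNge; apply: contra nodom; rewrite /gamma -cXd => cM.
  have [|Y XY YM] := superset_of_card _ Xd M; first by rewrite cM.
  by apply/existsP; exists Y; rewrite YM eqxx (dominating_superset _ _ XY).
(* Doubling [X0] gives [gamma_t G <= 2 * M.+2], the range in which [esc] makes a minimum total
   dominating set restrained. *)
have [Y0 tY0 cY0] := total_dominating_double _ nbr dX0.
have [Yt tYt cYt] := min_card_witness _ _ _ tY0.
have rYt : total_restrained_dominating G Yt.
  have /andP[dYt totYt] := tYt.
  rewrite /total_restrained_dominating totYt andbT.
  apply: escapes_restrained esc _ dYt; rewrite cYt -X0k.
  by apply: leq_trans cY0; apply: min_card_le.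
have eq_r : gamma_r G == gamma G.
  rewrite eqn_leq; apply/andP; split; last first.
    by apply: min_card_mono => X /andP[].
  rewrite -[gamma G]cXd; apply: min_card_le.
  apply: escapes_restrained esc _ dXd; rewrite cXd.
  by rewrite (leq_trans gamma_le) // leq_pmull.
have eq_t : gamma_tr G == gamma_t G.
  rewrite eqn_leq; apply/andP; split.
    by rewrite -[gamma_t G]cYt; apply: min_card_le.
  apply: min_card_mono => X /andP[/andP[dX _] tX].
  by rewrite /total_dominating dX.
rewrite eq_r eq_t (eqP eq_r).
apply/and5P; split => //.
- by apply/existsP; exists Yt.
- by apply/existsP; exists Yt.
- by rewrite eqn_leq gamma_ge andbT -ltnS orbC eqn_leq gamma_le /=; case: ltnP.
Qed.
End Deterministic.

(** * Expectations on the random graph *)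

Section Expectation.
Variables (R : realType) (T : finType) (p : R).
Hypothesis p01 : 0 < p < 1.
Let q := 1 - p.
Implicit Types (f g : sgraph T -> R) (E : pred (sgraph T)).

Definition Ex f : R := \sum_(G : sgraph T) gnp_weight p G * f G.
(** This is [gnp_prob] over an arbitrary finite vertex type; at ['I_n] the two are convertible. *)
Definition Pr E : R := \sum_(G : sgraph T | E G) gnp_weight p G.

Lemma gnp_weight_ge0 (G : sgraph T) : 0 <= gnp_weight p G.
Proof.
by apply: prodr_ge0 => e _; case/andP: p01 => *; case: ifP => _; lra.
Qed.

Lemma eq_Ex f g : f =1 g -> Ex f = Ex g.
Proof. by move=> fg; apply: eq_bigr => G _; rewrite fg. Qed.

Lemma ler_Ex f g : (forall G, f G <= g G) -> Ex f <= Ex g.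
Proof.
by move=> fg; apply: ler_sum => G _; rewrite ler_wpM2l ?gnp_weight_ge0.
Qed.

Lemma Ex_sum (I : finType) (P : pred I) (f : I -> sgraph T -> R) :
  Ex (fun G => \sum_(i | P i) f i G) = \sum_(i | P i) Ex (f i).
Proof. by rewrite exchange_big; apply: eq_bigr => G _; rewrite mulr_sumr. Qed.

Lemma ExZ c f : Ex (fun G => c * f G) = c * Ex f.
Proof. by rewrite mulr_sumr; apply: eq_bigr => G _; rewrite mulrCA. Qed.

Lemma PrE E : Pr E = Ex (fun G => (E G)%:R).
Proof.
rewrite /Pr big_mkcond; apply: eq_bigr => G _.
by case: (E G); rewrite ?mulr1 ?mulr0.
Qed.

Lemma ler_Pr E1 E2 : subpred E1 E2 -> Pr E1 <= Pr E2.
Proof.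
move=> E12; rewrite !PrE; apply: ler_Ex => G.
by rewrite ler_nat; case: (E1 G) (E12 G) => // ->.
Qed.

Lemma eq_Pr E1 E2 : E1 =1 E2 -> Pr E1 = Pr E2.
Proof. exact: eq_bigl. Qed.

Lemma Pr_exists (I : finType) (P : pred I) (E : I -> pred (sgraph T)) :
  Pr (fun G => [exists (i | P i), E i G]) <= \sum_(i | P i) Pr (E i).
Proof.
rewrite PrE (eq_bigr (fun i => Ex (fun G => (E i G)%:R))); last first.
  by move=> i _; rewrite PrE.
rewrite -Ex_sum; apply: ler_Ex => G.
have [/exists_inP[i Pi EiG]|_] := boolP [exists (i | P i), E i G]; last first.
  by apply: sumr_ge0 => i _; rewrite ler0n.
by rewrite (bigD1 i) //= EiG lerDl sumr_ge0.
Qed.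

(** The sum over graphs becomes a sum over all sets [J] of a product of weights, which factors as
    the product over [e] of [a e + b e]: this is [q] on [F] and 1 elsewhere. *)
Lemma Ex_no_edge (F : {set {set T}}) : F \subset vpairs T ->
  Ex (fun G => ([disjoint F & edges G])%:R) = q ^+ #|F|.
Proof.
move=> FV.
pose w (J : {set {set T}}) : R :=
  (\prod_(e in vpairs T) (if e \in J then p else 1 - p))
  * ([disjoint F & J])%:R.
have -> : Ex (fun G => ([disjoint F & edges G])%:R)
        = \sum_(J : {set {set T}} | J \subset vpairs T) w J.
  rewrite (reindex_omap (@edges T) insub) /=; last first.
    by move=> J JV; rewrite insubT.
  rewrite /Ex [RHS](eq_bigl xpredT) // => G.
  by rewrite (valP G) valK eqxx.
(* The zeros of [a] kill every [J] that meets [F] or contains a set that is not a pair. *)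
pose a (e : {set T}) : R :=
  if e \in vpairs T then (if e \in F then 0 else p) else 0.
pose b (e : {set T}) : R := if e \in vpairs T then 1 - p else 1.
transitivity (\sum_(J : {set {set T}}) \prod_e (if e \in J then a e else b e)).
  rewrite [RHS](bigID (fun J : {set {set T}} => J \subset vpairs T)) /= [X in _ + X]big1 => [|J].
    rewrite addr0; apply: eq_bigr => J JV.
    rewrite [RHS](bigID (mem (vpairs T))) /= [X in _ * X]big1 ?mulr1 => [|e]; last first.
      move=> eV; rewrite /b (negPf eV) ifN //.
      by apply: contra eV; apply: (fintype.subsetP JV).
    rewrite /w; have [dFJ|] := boolP [disjoint F & J].
      rewrite mulr1; apply: eq_bigr => e eV; rewrite /a /b eV.
      have [eJ|//] := ifP; rewrite ifN //.
      by rewrite (disjointFl dFJ).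
    rewrite -setI_eq0 => /set0Pn[e]; rewrite inE => /andP[eF eJ].
    rewrite mulr0 (bigD1 e) /=; last exact: (fintype.subsetP FV).
    by rewrite eJ /a eF (fintype.subsetP FV) // mul0r.
  move=> /fintype.subsetPn[e eJ eV].
  by rewrite (bigD1 e) //= eJ /a (negPf eV) mul0r.
rewrite -bigA_distr (bigID (mem F)) /= [X in _ * X]big1 ?mulr1 => [|e eF].
  rewrite -prodr_const; apply: eq_bigr => e eF.
  by rewrite /a /b (fintype.subsetP FV) // eF add0r.
by rewrite /a /b (negPf eF); case: ifP => _; rewrite ?add0r // addrC subrK.
Qed.

Lemma Ex1 : Ex (fun=> 1) = 1.
Proof.
have := Ex_no_edge _ (sub0set (vpairs T)); rewrite cards0 expr0 => E0.
rewrite -[RHS]E0; apply: eq_Ex => G.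
by rewrite -setI_eq0 set0I eqxx.
Qed.

Lemma Pr_ge0 E : 0 <= Pr E.
Proof. by apply: sumr_ge0 => G _; apply: gnp_weight_ge0. Qed.

Lemma PrC E : Pr E = 1 - Pr (fun G => ~~ E G).
Proof.
apply/esym/eqP; rewrite subr_eq -{1}Ex1 /Ex (bigID E) /= /Pr.
by apply/eqP; congr (_ + _); apply: eq_bigr => G _; rewrite mulr1.
Qed.

Lemma Pr_le1 E : Pr E <= 1.
Proof. by rewrite PrC gerBl Pr_ge0. Qed.

Definition noadj (G : sgraph T) (v : T) (D : {set T}) : bool :=
  [forall d in D, ~~ adj G v d].

(** Injectivity ensures that no edge is named twice in [Z], so that [#|Z|] counts edges. *)
Lemma Ex_noadj_pairs (Z : {set T * T}) :
    {in Z &, injective (fun z : T * T => [set z.1; z.2])} ->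
    (forall z, z \in Z -> z.1 != z.2) ->
  Ex (fun G => ([forall z in Z, ~~ adj G z.1 z.2])%:R) = q ^+ #|Z|.
Proof.
move=> Zinj Zne; rewrite -(card_in_imset Zinj) -Ex_no_edge; last first.
  apply/fintype.subsetP => e /imsetP[z zZ ->].
  by rewrite inE cards2 Zne.
apply: eq_Ex => G; congr (_%:R); congr nat_of_bool.
apply/forall_inP/idP => [zG|dG z zZ]; last first.
  by rewrite /adj (disjointFr dG (imset_f _ zZ)).
by rewrite disjoint_subset; apply/fintype.subsetP => e /imsetP[z zZ ->]; apply: zG.
Qed.

(* Expanding the product into a signed sum of "no edge in F" indicators reduces
   independence to Ex_no_edge. *)
Lemma Ex_prod_noadj (J : finType) (j0 : J) (c : J -> R) (D : J -> {set T})
    (S : {set T}) : (forall j, D j \subset ~: S) ->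
  Ex (fun G => \prod_(v in S) \sum_j c j * (noadj G v (D j))%:R) =
  (\sum_j c j * q ^+ #|D j|) ^+ #|S|.
Proof.
(* A product of sums is a sum over choice functions [h]; [j0] is their value outside [S]. *)
move=> DS; rewrite -prodr_const (big_distr_big j0) /=.
under eq_Ex do rewrite (big_distr_big j0) /=.
rewrite Ex_sum; apply: eq_bigr => h _.
under eq_Ex do rewrite big_split /=.
rewrite ExZ big_split /=; congr (_ * _).
pose Z := [set z : T * T | (z.1 \in S) && (z.2 \in D (h z.1))].
(* Pairs in [Z] go from [S] to its complement, so no edge occurs in both orientations. *)
have ZS z : z \in Z -> (z.1 \in S) && (z.2 \notin S).
  rewrite inE => /andP[-> zD] /=.
  by have := fintype.subsetP (DS _) _ zD; rewrite inE.
transitivity (Ex (fun G => ([forall z in Z, ~~ adj G z.1 z.2])%:R)).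
  apply: eq_Ex => G; have [/forall_inP zG|] := boolP [forall z in Z, ~~ adj G z.1 z.2].
    apply: big1 => v vS; rewrite (_ : noadj _ _ _) //.
    by apply/forall_inP => d dD; apply: (zG (v, d)); rewrite inE /= vS.
  rewrite negb_forall => /existsP[z]; rewrite negb_imply negbK inE.
  move=> /andP[/andP[zS zD] zG]; rewrite (bigD1 z.1) //= (_ : noadj _ _ _ = false) ?mul0r //.
  by apply/negbTE; rewrite negb_forall; apply/existsP; exists z.2; rewrite zD zG.
rewrite Ex_noadj_pairs => [|[x y] [x' y'] /ZS/=/andP[xS yS] /ZS/=/andP[x'S y'S] exy|z /ZS/andP[z1 z2]].
- have -> : #|Z| = (\sum_(v in S) #|D (h v)|)%N.
    rewrite -sum1_card (eq_bigr (fun v => \sum_(d in D (h v)) 1)%N); last first.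
      by move=> v _; rewrite sum1_card.
    by rewrite pair_big_dep /=; apply: eq_bigl => z; rewrite inE.
  by rewrite (big_morph (fun k => q ^+ k) (exprD q) (expr0 q)).
- have : x \in [set x'; y'] by rewrite -exy set21.
  have : y \in [set x'; y'] by rewrite -exy set22.
  rewrite !inE => /orP[/eqP yx'|/eqP ->]; first by rewrite yx' x'S in yS.
  by move=> /orP[/eqP ->//|/eqP xy']; rewrite -xy' xS in y'S.
- by apply: contraNneq z2 => <-.
Qed.

Lemma dominatingE (G : sgraph T) (A : {set T}) :
  dominating G A = [forall u in ~: A, ~~ noadj G u A].
Proof.
apply: eq_forallb => u; congr (_ ==> _).
by rewrite negb_forall; apply: eq_existsb => v; rewrite negb_imply negbK.
Qed.

Lemma forall_in_natr (S : {set T}) (b : T -> bool) :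
  ([forall v in S, b v])%:R = \prod_(v in S) (b v)%:R :> R.
Proof.
have [/forall_inP bS|] := boolP [forall v in S, b v].
  by rewrite big1 // => v vS; rewrite bS.
rewrite negb_forall => /existsP[v]; rewrite negb_imply => /andP[vS bv].
by rewrite (bigD1 v) //= (negPf bv) mul0r.
Qed.

(** Each vertex outside [A] contributes 1 minus the indicator of having no neighbour in [A]. In the
    sum over booleans, [true] encodes the constant 1 as [noadj] to [set0]. *)
Lemma Pr_dominating (A : {set T}) :
  Pr (fun G => dominating G A) = (1 - q ^+ #|A|) ^+ (#|T| - #|A|).
Proof.
have := Ex_prod_noadj _ true (fun b : bool => if b then 1 else - 1)
  (fun b : bool => if b then set0 else A) (~: A).
rewrite big_bool /= cards0 !mul1r expr0 mulN1r [#|~: A|]cardsCs setCK => <-; last first.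
  by case; rewrite ?sub0set // setCK.
rewrite PrE; apply: eq_Ex => G; rewrite dominatingE forall_in_natr.
apply: eq_bigr => v _; rewrite big_bool /= mul1r mulN1r.
have -> : noadj G v set0 by apply/forall_inP => d; rewrite inE.
by case: noadj; rewrite ?subrr ?subr0.
Qed.

(** Only the vertices outside [A :|: B] are kept, hence an inequality. For each of them (1 - a)(1 -
    b) is expanded, where the product ab of the two [noadj] indicators is the indicator for
    [A :|: B]. *)
Lemma Pr_dominating2_le (A B : {set T}) :
  Pr (fun G => dominating G A && dominating G B) <=
  (1 - q ^+ #|A| - q ^+ #|B| + q ^+ #|A :|: B|) ^+ (#|T| - #|A :|: B|).
Proof.
have := Ex_prod_noadj _ (true, true)
  (fun ab : bool * bool => (if ab.1 then 1 else - 1) * (if ab.2 then 1 else - 1))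
  (fun ab : bool * bool =>
     (if ab.1 then set0 else A) :|: (if ab.2 then set0 else B)) (~: (A :|: B)).
rewrite -(pair_bigA _ (fun a b : bool => ((if a then 1 else - 1) * (if b then 1 else - 1)) *
 q ^+ #|(if a then set0 else A) :|: (if b then set0 else B)|)) /=.
rewrite !big_bool /= !setU0 !set0U cards0 expr0 [#|~: (A :|: B)|]cardsCs setCK => HE.
rewrite [leRHS](_ : _ = (1 * 1 * 1 + 1 * -1 * q ^+ #|B| +
 (-1 * 1 * q ^+ #|A| + -1 * -1 * q ^+ #|A :|: B|)) ^+ (#|T| - #|A :|: B|)); last by congr (_ ^+ _); ring.
rewrite -HE; last first.
  by case=> [[] []] /=; rewrite ?setU0 ?set0U ?sub0set ?subsetUl ?subsetUr ?fintype.subxx.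
rewrite PrE; apply: ler_Ex => G.
under eq_bigr => v _.
  rewrite (_ : \sum_j _ = (~~ noadj G v A && ~~ noadj G v B)%:R); first over.
  rewrite -(pair_bigA _ (fun a b : bool => ((if a then 1 else - 1) * (if b then 1 else - 1)) *
   (noadj G v ((if a then set0 else A) :|: (if b then set0 else B)))%:R)) /=.
  rewrite !big_bool /= !setU0 !set0U.
  have -> : noadj G v set0 by apply/forall_inP => d; rewrite inE.
  have -> : noadj G v (A :|: B) = noadj G v A && noadj G v B.
    apply/forall_inP/andP => [vAB|[/forall_inP vA /forall_inP vB] d].
      by split; apply/forall_inP => d dA; apply: vAB; rewrite inE dA ?orbT.
    by rewrite inE => /orP[/vA|/vB].
  by do 2!case: noadj => /=; ring.
rewrite -forall_in_natr !dominatingE ler_nat.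
have [/andP[/forall_inP dA /forall_inP dB]|//] := boolP (_ && _).
rewrite lt0b; apply/forall_inP => v; rewrite setCU inE => /andP[vA vB].
by rewrite dA ?dB.
Qed.

End Expectation.

(** * First and second moment bounds *)

Section Counting.

(** Division-free form of C(n-r, k-r) / C(n, k) <= (k/n)^r: the quotient has [r] factors
    (k-i)/(n-i), each at most k/n. *)
Lemma bin_sub_le n k r : (r <= k <= n)%N ->
  ('C(n - r, k - r) * n ^ r <= 'C(n, k) * k ^ r)%N.
Proof.
elim: r => [|r IHr] /andP[rk kn]; first by rewrite !subn0.
have {}IHr := IHr (introT andP (conj (ltnW rk) kn)).
have nr0 : (0 < n - r)%N by rewrite subn_gt0 (leq_trans rk).
have := mul_bin_diag (n - r) (k - r).-1.
rewrite prednK ?subn_gt0 // -!subnS => E.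
rewrite -(leq_pmul2l nr0) mulnA E [(n ^ r.+1)%N]expnS [(k ^ r.+1)%N]expnS.
have kr : ((k - r) * n <= k * (n - r))%N.
  by rewrite mulnBl mulnBr leq_sub2l // mulnC leq_mul2l kn orbT.
rewrite mulnACA [('C(n, k) * _)%N]mulnCA [leqRHS]mulnA [((n - r) * k)%N]mulnC.
exact: leq_mul.
Qed.

(** Such a [B] is the union of an [r]-subset [R] of [A] and of [k - r] points outside [R]; counting
    the pairs may count [B] several times. *)
Lemma card_large_meet (T : finType) (A : {set T}) k r : (r <= k)%N ->
  (#|[set B : {set T} | (#|B| == k) && (r <= #|A :&: B|)]|
   <= 'C(#|A|, r) * 'C(#|T| - r, k - r))%N.
Proof.
move=> rk; rewrite -(cards_draws A r).
pose F := [set R : {set T} | R \subset A & #|R| == r].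
pose H (R : {set T}) := [set C : {set T} | C \subset ~: R & #|C| == (k - r)%N].
pose Z := [set z : {set T} * {set T} | (z.1 \in F) && (z.2 \in H z.1)].
have cZ : (#|Z| = #|F| * 'C(#|T| - r, k - r))%N.
  transitivity (\sum_(X in F) \sum_(Y in H X) 1)%N.
    by rewrite -sum1_card pair_big_dep /=; apply: eq_bigl => z; rewrite inE.
  rewrite -sum_nat_const; apply: eq_bigr => X; rewrite inE => /andP[_ /eqP Xr].
  by rewrite sum1_card cards_draws cardsCs setCK Xr.
rewrite -cZ; apply: leq_trans (leq_imset_card (fun z => z.1 :|: z.2) Z).
apply: subset_leq_card; apply/fintype.subsetP => B; rewrite inE => /andP[/eqP Bk rAB].
have : (0 < #|[set R : {set T} | R \subset A :&: B & #|R| == r]|)%N.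
  by rewrite cards_draws bin_gt0.
rewrite card_gt0 => /set0Pn[R]; rewrite inE => /andP[RAB /eqP Rr].
move: RAB; rewrite subsetI => /andP[RA RB].
apply/imsetP; exists (R, B :\: R); last first.
  by rewrite /= -{1}(setID B R) (setIidPr RB).
rewrite !inE /= RA Rr eqxx /= setDE subsetIr /=.
by rewrite -setDE cardsDS // Bk Rr.
Qed.

End Counting.

Section Bounds.
Variables (R : realType) (T : finType) (p : R).
Hypothesis p01 : 0 < p < 1.
Let q := 1 - p.
Let n := #|T|.
Let q_gt0 : 0 < q. Proof. by case/andP: p01 => *; rewrite /q; lra. Qed.
Let q_lt1 : q < 1. Proof. by case/andP: p01 => *; rewrite /q; lra. Qed.
Local Notation Pr := (@Pr R T p).
Local Notation Ex := (@Ex R T p).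

Lemma Pr_exists_dominating_le k :
  Pr (fun G => [exists X : {set T}, (#|X| == k) && dominating G X])
  <= 'C(n, k)%:R * (1 - q ^+ k) ^+ (n - k).
Proof.
apply: le_trans (Pr_exists _ _ _ p01 _ _ _) _.
rewrite (eq_bigr (fun=> (1 - q ^+ k) ^+ (n - k))) => [|X /eqP Xk]; last first.
  by rewrite Pr_dominating Xk.
by rewrite -(card_draws T k) mulr_natl -sumr_const; under [leRHS]eq_bigl do rewrite inE.
Qed.

Lemma Pr_noadj (v : T) (D : {set T}) : v \notin D ->
  Pr (fun G => noadj T G v D) = q ^+ #|D|.
Proof.
move=> vD; have := Ex_prod_noadj R T p _ (ord0 : 'I_1) (fun=> 1) (fun=> D) [set v].
rewrite big_ord1 mul1r cards1 expr1 => <-; last first.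
  by move=> _; rewrite subsetC sub1set inE.
by rewrite PrE; apply: eq_Ex => G; rewrite big_set1 big_ord1 mul1r.
Qed.

Lemma Pr_not_escapes_le k :
  Pr (fun G => [exists Xu : {set T} * T,
                (#|Xu.1| == k) && noadj T G Xu.2 (~: Xu.1)])
  <= 'C(n, k)%:R * n%:R * q ^+ (n - k.+1).
Proof.
apply: le_trans (Pr_exists _ _ _ p01 _ _ _) _.
rewrite (eq_bigl (fun z : {set T} * T => (#|z.1| == k) && true)); last first.
  by move=> z; rewrite andbT.
rewrite -(pair_big (fun X : {set T} => #|X| == k) xpredT (fun X u =>
  Pr (fun G => noadj T G u (~: X)))) /=.
rewrite -(card_draws T k) -mulrA mulr_natl -sumr_const.
under [leRHS]eq_bigl do rewrite inE.
apply: ler_sum => X /eqP Xk; rewrite mulr_natl -sumr_const.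
apply: ler_sum => u _.
(* A vertex is never adjacent to itself, so [u] is removed from the complement; whence [k.+1] in the
   exponent. *)
apply: (@le_trans _ _ (Pr (fun G => noadj T G u (~: X :\ u)))).
  apply: ler_Pr => // G /forall_inP uX; apply/forall_inP => d.
  by rewrite inE => /andP[_]; apply: uX.
rewrite Pr_noadj ?setD11 // ler_wiXn2l ?(ltW q_gt0) ?(ltW q_lt1) //.
have := cardsD1 u (~: X); rewrite [#|~: X|]cardsCs setCK Xk -/n.
by case: (u \in _) => /=; lia.
Qed.

(** On [E] the square of [f - mu] equals [mu ^+ 2], so [mu ^+ 2 * Pr E] is at most the variance. *)
Lemma chebyshev0 (f : sgraph T -> R) (E : pred (sgraph T)) (mu : R) :
    0 < mu -> Ex f = mu -> (forall G, E G -> f G = 0) ->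
  Pr E <= Ex (fun G => f G ^+ 2) / mu ^+ 2 - 1.
Proof.
move=> mu0 fmu fE.
rewrite -(ler_pM2l (exprn_gt0 2 mu0)) mulrBr mulr1 mulrCA divff ?mulr1; last first.
  by rewrite expf_neq0 // gt_eqF.
rewrite PrE -ExZ.
have -> : Ex (fun G => f G ^+ 2) - mu ^+ 2 = Ex (fun G => (f G - mu) ^+ 2).
  have -> : Ex (fun G => (f G - mu) ^+ 2)
     = Ex (fun G => f G ^+ 2) + (- 2 * mu) * Ex f + mu ^+ 2 * Ex (fun=> 1).
    rewrite -!ExZ /Ex -!big_split /=; apply: eq_bigr => G _; ring.
  by rewrite fmu Ex1; ring.
apply: ler_Ex => // G; have [EG|_] := boolP (E G); last first.
  by rewrite mulr0 sqr_ge0.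
by rewrite fE // mulr1 sub0r sqrrN.
Qed.

(** With x = q^k and z = q^|A∪B|, the factor 1 - 2x + z per vertex is compared with (1 - x)^2, its
    value under independence; z <= x^2 q^(-r) because |A∪B| >= 2k - r. *)
Lemma Pr_dominating2_bound k r (A B : {set T}) :
    (0 < k)%N -> (2 * k <= n)%N -> q ^+ k <= 2^-1 ->
    #|A| = k -> #|B| = k -> (#|A :&: B| <= r)%N ->
  Pr (fun G => dominating G A && dominating G B) <=
  ((1 - q ^+ k) ^+ (n - k)) ^+ 2
  * expR (4 * (n%:R * (q ^+ k) ^+ 2 * q ^- r) + 4 * (k%:R * q ^+ k)).
Proof.
move=> k0 kn x2 Ak Bk ABr; set x := q ^+ k in x2 *.
apply: le_trans (Pr_dominating2_le _ _ _ p01 A B) _.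
rewrite -/q -/n Ak Bk -/x; set z := q ^+ #|A :|: B|.
have x0 : 0 < x by apply: exprn_gt0.
have z0 : 0 < z by apply: exprn_gt0.
have cUI : (#|A :|: B| + #|A :&: B| = 2 * k)%N by rewrite cardsUI Ak Bk; lia.
have zx : z <= x.
  by apply: ler_wiXn2l; rewrite ?(ltW q_gt0) ?(ltW q_lt1) // -Ak subset_leq_card ?subsetUl.
have zxr : z <= x ^+ 2 * q ^- r.
  rewrite -(ler_pM2r (exprn_gt0 r q_gt0)) -mulrA mulVf ?mulr1; last first.
    by rewrite expf_neq0 // gt_eqF.
  rewrite /z /x -exprM mulnC -exprD.
  apply: ler_wiXn2l; rewrite ?(ltW q_gt0) ?(ltW q_lt1) //; lia.
have b0 : 0 <= 1 - x - x + z by lra.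
have b1 : 1 - x - x + z <= 1 by lra.
apply: (@le_trans _ _ ((1 - x - x + z) ^+ (n - 2 * k))).
  by apply: ler_wiXn2l => //; lia.
(* Since x <= 1/2, 4(1 - x)^2 >= 1 and (1 - x)^2 (1 + 4z) >= (1 - x)^2 + z. *)
have y1 : 1 - x - x + z <= (1 - x) ^+ 2 * expR (4 * z).
  have h : 1 + 4 * z <= expR (4 * z) := expR_ge1Dx _.
  have h2 : (1 - x) ^+ 2 * (1 + 4 * z) <= (1 - x) ^+ 2 * expR (4 * z).
    by rewrite ler_wpM2l // sqr_ge0.
  have h3 : 1 <= 4 * (1 - x) ^+ 2 by nra.
  have h4 : z * 1 <= z * (4 * (1 - x) ^+ 2) by rewrite ler_wpM2l // ltW.
  by apply: le_trans h2; have := sqr_ge0 x; lra.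
have y2 : 1 <= (1 - x) * expR (2 * x).
  have h : 1 + 2 * x <= expR (2 * x) := expR_ge1Dx _.
  have h2 : (1 - x) * (1 + 2 * x) <= (1 - x) * expR (2 * x).
    by rewrite ler_wpM2l //; lra.
  by apply: le_trans h2; nra.
apply: (@le_trans _ _ (((1 - x) ^+ 2 * expR (4 * z)) ^+ (n - 2 * k))).
  by apply: lerXn2r => //; rewrite nnegrE (le_trans b0).
(* The extra factor, at least 1, raises the exponent of [1 - x] from [2 * (n - 2 * k)] to
   [2 * (n - k)]; its price is the term in [k%:R * q ^+ k]. *)
apply: (@le_trans _ _ ((((1 - x) ^+ 2 * expR (4 * z)) ^+ (n - 2 * k)) *
   (((1 - x) * expR (2 * x)) ^+ (2 * k)))).
  rewrite ler_peMr ?exprn_ege1 // exprn_ge0 // (le_trans b0) //.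
rewrite [(_ * expR (4 * z)) ^+ _]exprMn [(_ * expR (2 * x)) ^+ _]exprMn.
rewrite -!expRM_natr -![(1 - x) ^+ _ ^+ _]exprM mulrACA -exprD -expRD.
rewrite (_ : (2 * (n - 2 * k) + 2 * k = (n - k) * 2)%N); last by lia.
rewrite ler_wpM2l ?exprn_ge0 ?ler_expR //; first by lra.
apply: lerD; last by rewrite natrM; lra.
rewrite -[4 * z * _]mulrA -[n%:R * _ * _]mulrA ler_wpM2l // mulrC.
by rewrite ler_pM ?ler_nat ?leq_subr // ltW.
Qed.

(** Since 1/(1 - x) = 1 + x/(1 - x) <= exp(x/(1 - x)). This replaces the inverse of a domination
    probability by an explicit exponential. *)
Lemma inv_dominating_le k : (0 < k)%N ->
  1 <= (1 - q ^+ k) ^+ (n - k) * expR (n%:R * (q ^+ k / (1 - q ^+ k))).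
Proof.
move=> k0; set x := q ^+ k.
have x0 : 0 < x by apply: exprn_gt0.
have x1 : x < 1 by rewrite exprn_ilt1 ?ltW // -lt0n.
have y0 : 0 <= x / (1 - x) by rewrite divr_ge0 ?(ltW x0) // subr_ge0 ltW.
apply: (@le_trans _ _ ((1 - x) ^+ (n - k) * expR ((n - k)%:R * (x / (1 - x))))).
  rewrite expRM_natl -exprMn exprn_ege1 //.
  have h : 1 + x / (1 - x) <= expR (x / (1 - x)) := expR_ge1Dx _.
  have h2 : (1 - x) * (1 + x / (1 - x)) <= (1 - x) * expR (x / (1 - x)).
    by rewrite ler_wpM2l // subr_ge0 ltW.
  apply: le_trans h2; rewrite mulrDr mulrCA divff ?mulr1; last by rewrite subr_eq0 gt_eqF.
  by rewrite subrK.
rewrite ler_wpM2l ?exprn_ge0 ?subr_ge0 ?(ltW x1) // ler_expR ler_wpM2r //.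
by rewrite ler_nat leq_subr.
Qed.

(** Chebyshev for the number of dominating [k]-sets. Pairs meeting in fewer than [r] points yield
    the exponential minus 1, the other pairs the last term. *)
Lemma Pr_no_dominating_le k r :
    (0 < k)%N -> (2 * k <= n)%N -> q ^+ k <= 2^-1 -> (r <= k)%N ->
  Pr (fun G => ~~ [exists X : {set T}, (#|X| == k) && dominating G X]) <=
  expR (4 * (n%:R * (q ^+ k) ^+ 2 * q ^- r) + 4 * (k%:R * q ^+ k)) - 1
  + 2 ^+ k * (k%:R / n%:R) ^+ r * expR (n%:R * (q ^+ k / (1 - q ^+ k))).
Proof.
move=> k0 kn x2 rk; set x := q ^+ k in x2 *.
set ey := expR (4 * _ + _); set ez := expR (n%:R * _).
pose P1 := (1 - x) ^+ (n - k).
have x0 : 0 < x by apply: exprn_gt0.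
have P10 : 0 < P1 by apply: exprn_gt0; lra.
have n0 : (0 < n)%N by lia.
pose C : R := 'C(n, k)%:R.
have C0 : 0 < C by rewrite ltr0n bin_gt0; lia.
pose X (G : sgraph T) : R := \sum_(A : {set T} | #|A| == k) (dominating G A)%:R.
have sumC (c : R) : \sum_(A : {set T} | #|A| == k) c = C * c.
  rewrite /C -(card_draws T k) mulr_natl -sumr_const.
  by under [RHS]eq_bigl do rewrite inE.
have EX : Ex X = C * P1.
  rewrite Ex_sum -sumC; apply: eq_bigr => A /eqP Ak.
  by rewrite -PrE Pr_dominating // Ak.
(* [N] bounds the number of [B] that meet a given [A] in at least [r] points, through C(k, r) <= 2^k
   and [bin_sub_le]. *)
pose N : R := C * (2 ^+ k * (k%:R / n%:R) ^+ r).
have EX2 : Ex (fun G => X G ^+ 2) <= C * (C * (P1 ^+ 2 * ey) + N * P1).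
  rewrite (eq_Ex _ _ _ _ (fun G => \sum_(A : {set T} | #|A| == k)
     \sum_(B : {set T} | #|B| == k) (dominating G A && dominating G B)%:R)); last first.
    move=> G; rewrite expr2 mulr_suml; apply: eq_bigr => A _.
    by rewrite mulr_sumr; apply: eq_bigr => B _; rewrite -natrM mulnb.
  rewrite Ex_sum -sumC; apply: ler_sum => A /eqP Ak.
  rewrite Ex_sum (bigID (fun B : {set T} => #|A :&: B| < r)%N) /=.
  apply: lerD.
    rewrite -sumC [leRHS](bigID (fun B : {set T} => #|A :&: B| < r)%N) /=.
    rewrite ler_wpDr ?sumr_ge0 // => [B _|]; first by rewrite mulr_ge0 ?sqr_ge0 ?expR_ge0.
    apply: ler_sum => B /andP[/eqP Bk ABr].
    by rewrite -PrE; apply: Pr_dominating2_bound => //; apply: ltnW.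
  apply: (@le_trans _ _ (\sum_(B : {set T} | (#|B| == k) && ~~ (#|A :&: B| < r)%N) P1)).
    apply: ler_sum => B /andP[/eqP Bk ABr].
    rewrite -PrE; apply: (@le_trans _ _ (Pr (fun G => dominating G B))).
      by apply: ler_Pr => // G /andP[].
    by rewrite Pr_dominating // Bk.
  rewrite (eq_bigl (mem [set B : {set T} | (#|B| == k) && (r <= #|A :&: B|)%N])); last first.
    by move=> B; rewrite /= inE -leqNgt.
  rewrite sumr_const -mulr_natl ler_wpM2r ?(ltW P10) //.
  apply: (@le_trans _ _ ('C(k, r) * 'C(n - r, k - r))%:R).
    by have := card_large_meet _ A _ _ rk; rewrite Ak ler_nat.
  rewrite /N natrM mulrCA ler_pM //.
    rewrite -natrX ler_nat; have := Pascal 1 1 k; rewrite addn1 => ->.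
    rewrite (bigD1 (inord r)) //= inordK ?ltnS // !exp1n !muln1.
    exact: leq_addr.
  rewrite exprMn exprVn mulrA ler_pdivlMr ?exprn_gt0 ?ltr0n //.
  by rewrite -!natrX -!natrM ler_nat bin_sub_le // rk; lia.
have mu0 : 0 < C * P1 by apply: mulr_gt0.
apply: le_trans (chebyshev0 _ _ _ mu0 EX _) _.
  move=> G; rewrite negb_exists => /forallP noX; apply: big1 => A Ak.
  by have := noX A; rewrite Ak /= => /negPf ->.
rewrite addrAC lerD2r ler_pdivrMr ?exprn_gt0 //.
apply: (le_trans EX2).
(* Dividing by [(C * P1) ^+ 2] leaves one inverse of [P1], which [ez] absorbs. *)
have P1ez : 1 <= P1 * ez by apply: inv_dominating_le.
rewrite (_ : (ey + _) * _ = C * (C * (P1 ^+ 2 * ey) + N * P1 * (P1 * ez))); last first.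
  by rewrite /N; ring.
rewrite ler_wpM2l ?(ltW C0) // lerD2l ler_peMr // mulr_ge0 ?(ltW P10) //.
by rewrite mulr_ge0 ?(ltW C0) // mulr_ge0 ?exprn_ge0 ?divr_ge0.
Qed.

End Bounds.

(** * Union bound over the three failure events *)

Section Union.
Variables (R : realType) (T : finType) (p : R).
Hypothesis p01 : 0 < p < 1.
Let q := 1 - p.
Let n := #|T|.

(** The conclusion of [gamma_concentration] as an event, with a natural number [M] in place of the
    integer floor. *)
Definition concentrated M (G : sgraph T) : bool :=
  [&& gamma_r G == gamma G,
      [exists X, total_dominating G X],
      [exists X, total_restrained_dominating G X],
      gamma_tr G == gamma_t G
    & (gamma_r G == M.+1) || (gamma_r G == M.+2)].

(** The summands bound in turn: a dominating [M]-set, a vertex without neighbour outside some set of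
    [2 * M.+2] vertices, no dominating [M.+2]-set. When none occurs, [gamma_concentration]
    applies. *)
Lemma Pr_not_concentrated_le M r :
    (2 * M.+2 <= n)%N -> q ^+ M.+2 <= 2^-1 -> (r <= M.+2)%N ->
  Pr R T p (fun G => ~~ concentrated M G) <=
    'C(n, M)%:R * (1 - q ^+ M) ^+ (n - M)
  + 'C(n, 2 * M.+2)%:R * n%:R * q ^+ (n - (2 * M.+2).+1)
  + (expR (4 * (n%:R * (q ^+ M.+2) ^+ 2 * q ^- r) + 4 * (M.+2%:R * q ^+ M.+2)) - 1
     + 2 ^+ M.+2 * (M.+2%:R / n%:R) ^+ r
       * expR (n%:R * (q ^+ M.+2 / (1 - q ^+ M.+2)))).
Proof.
move=> Kn x2 rM; have ba := Pr_exists_dominating_le R T p p01 M.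
have bb := Pr_no_dominating_le R T p p01 M.+2 r isT Kn x2 rM.
have bc := Pr_not_escapes_le R T p p01 (2 * M.+2).
apply: le_trans (lerD (lerD ba bc) bb); rewrite !PrE /Ex -!big_split /=.
apply: ler_sum => G _; rewrite -!mulrDr ler_wpM2l ?gnp_weight_ge0 //.
rewrite -!natrD ler_nat.
have [//|] := boolP (concentrated M G); case: (boolP [exists X : {set T}, (#|X| == M) && _]) => //= noA.
case: (boolP [exists Xu : {set T} * T, _]) => //= noC.
case: (boolP [exists X : {set T}, (#|X| == M.+2) && _]) => //= exB.
suff -> : concentrated M G by [].
apply: gamma_concentration => //; first by rewrite -/n; lia.
move=> X u XK; have [|Y XY YK] := superset_of_card _ X (2 * M.+2); first by rewrite XK.
move: noC; rewrite negb_exists => /forallP/(_ (Y, u)); rewrite /= YK eqxx /=.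
rewrite negb_forall => /existsP[v]; rewrite negb_imply negbK inE => /andP[vY uv].
apply/exists_inP; exists v => //; rewrite inE; apply: contra vY.
exact: (fintype.subsetP XY).
Qed.

End Union.

(** * Estimates at the threshold *)

Lemma bin_le_expn n m : ('C(n, m) <= n ^ m)%N.
Proof.
apply: (@leq_trans (n ^_ m)); first by rewrite -bin_ffact leq_pmulr ?fact_gt0.
elim: m n => [|m IHm] n; first by rewrite ffactn0.
rewrite ffactnS expnS leq_mul2l (leq_trans (IHm _)) ?orbT //.
by case: m {IHm} => // m; rewrite leq_exp2r // leq_pred.
Qed.

Section Estimates.
Variables (R : realType) (lam u : R) (n M : nat).
Let q := expR (- lam).
Let d := (1 - q) / 2.
Let L := u / lam.
Let t := (u - 2 * ln u + ln lam) / lam.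
Hypotheses (lam0 : 0 < lam) (u1 : 1 <= u) (nu : n%:R = expR u).
Hypotheses (Mt : M%:R <= t) (tM : t < M%:R + 1).
Hypothesis (lnu_ge : 2 * lam <= 2 * ln u - ln lam).

Let u0 : 0 < u. Proof. exact: lt_le_trans ltr01 u1. Qed.
Let q0 : 0 < q. Proof. exact: expR_gt0. Qed.
Let q1 : q < 1. Proof. by rewrite /q expR_lt1 oppr_lt0. Qed.
Let d0 : 0 < d. Proof. by rewrite /d divr_gt0 // subr_gt0. Qed.
Let n0 : 0 < n%:R :> R. Proof. by rewrite nu expR_gt0. Qed.
Let L0 : 0 < L. Proof. by rewrite /L divr_gt0. Qed.

Ltac slra := have ? := Mt; have ? := tM; have ? := lnu_ge; have ? := u1; have ? := lam0;
 have ? := u0; have ? := q0; have ? := q1; have ? := d0;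
  have ? := n0; have ? := L0; lra.

(** Here t = L - (2 ln u - ln lam)/lam, and [lnu_ge] makes the subtracted term at least 2. This
    absorbs the 2 of [M.+2]. *)
Let tL : t <= L - 2.
Proof.
rewrite /t /L -(ler_pM2r lam0) mulrBl !divfK ?gt_eqF //; slra.
Qed.

(** Says that n q^t = u L, the identity behind the choice of [t]. *)
Let exp_lam_t : expR (- (lam * t)) = u ^+ 2 / (lam * n%:R).
Proof.
rewrite /t mulrC divfK ?gt_eqF // nu.
rewrite (_ : - _ = ln u + ln u - ln lam - u); last by ring.
rewrite !(expRD, expRN) !lnK ?posrE // invfM mulrA expr2; ring.
Qed.

Let qX k : q ^+ k = expR (- (lam * k%:R)).
Proof. by rewrite /q -expRM_natr mulNr. Qed.

Lemma qM_ge : u ^+ 2 / (lam * n%:R) <= q ^+ M.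
Proof. by rewrite -exp_lam_t qX ler_expR lerN2 ler_pM2l. Qed.

(** As M + 2 > t + 1, a factor [q] is gained over q^t; the second moment bound lives on this
    gain. *)
Lemma qMS_le : q ^+ M.+2 <= q * (u ^+ 2 / (lam * n%:R)).
Proof.
rewrite -exp_lam_t exprS ler_pM2l // qX ler_expR lerN2 ler_pM2l //.
by rewrite -natr1; slra.
Qed.

Lemma MS_le : M.+2%:R <= L.
Proof. by rewrite -[M.+2]addn2 natrD; have := tL => ?; slra. Qed.

(** The exponent is at most ut - uL(1 - M/n) <= u(L - 2) - uL + u = -u; the first hypothesis says
    L^2 <= n, whence LM/n <= 1. *)
Lemma dominating_estimate :
    u ^+ 2 <= lam ^+ 2 * expR u -> (M <= n)%N ->
  'C(n, M)%:R * (1 - q ^+ M) ^+ (n - M) <= expR (- u).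
Proof.
move=> u2 Mn.
have C_le : 'C(n, M)%:R <= expR (u * M%:R).
  by rewrite expRM_natr -nu -natrX ler_nat bin_le_expn.
have y0 : 0 <= 1 - q ^+ M by rewrite subr_ge0 exprn_ile1 // ltW.
have P_le : (1 - q ^+ M) ^+ (n - M) <= expR (- (q ^+ M) * (n - M)%:R).
  rewrite expRM_natr lerXn2r ?nnegrE ?expR_ge0 //.
  exact: expR_ge1Dx.
apply: (le_trans (ler_pM _ _ C_le P_le)) => //; first by rewrite exprn_ge0.
rewrite -expRD ler_expR natrB //.
have h1 : u * M%:R <= u * t by rewrite ler_pM2l.
have h2 : u ^+ 2 / (lam * n%:R) * (n%:R - M%:R) <= q ^+ M * (n%:R - M%:R).
  by rewrite ler_wpM2r ?qM_ge // subr_ge0 ler_nat.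
have h3 : u ^+ 2 / (lam * n%:R) * (n%:R - M%:R) = u * L - u * L * (M%:R / n%:R).
  rewrite /L; field; slra.
have h4 : L * (M%:R / n%:R) <= 1.
  rewrite mulrA ler_pdivrMr // mul1r.
  apply: (@le_trans _ _ (L * L)); first by rewrite ler_pM2l //; have := tL => ?; slra.
  by rewrite /L nu mulrACA -invfM -!expr2 ler_pdivrMr ?exprn_gt0 // mulrC.
have h5 : u * t <= u * (L - 2) by rewrite ler_pM2l.
have h6 : u * (L * (M%:R / n%:R)) <= u * 1 by rewrite ler_pM2l.
slra.
Qed.

(** With K = 2(M + 2) <= 2L, the exponent is at most (K + 1)(u + lam) - lam n. *)
Lemma escape_estimate :
    (2 * L + 1) * (u + lam) + u <= lam * expR u ->
  (2 * M.+2 < n)%N /\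
  'C(n, 2 * M.+2)%:R * n%:R * q ^+ (n - (2 * M.+2).+1) <= expR (- u).
Proof.
move=> hn; set K := (2 * M.+2)%N.
have KL : K%:R + 1 <= 2 * L + 1 :> R by rewrite natrM; have := MS_le => ?; slra.
have Kn : (K < n)%N.
  rewrite -(ltr_nat R) nu -(ltr_pM2l lam0) (lt_le_trans _ hn) //.
  have : lam * (K%:R + 1) <= lam * (2 * L + 1) by rewrite ler_pM2l.
  have : 0 < u * (2 * L + 1) by rewrite mulr_gt0 //; slra.
  slra.
split => //; have C_le : 'C(n, K)%:R <= expR (u * K%:R).
  by rewrite expRM_natr -nu -natrX ler_nat bin_le_expn.
apply: (@le_trans _ _ (expR (u * K%:R) * n%:R * q ^+ (n - K.+1))).
  by rewrite !ler_wpM2r ?exprn_ge0 // ltW.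
rewrite nu qX -!expRD ler_expR natrB // nu -natr1.
have : (K%:R + 1) * (u + lam) <= (2 * L + 1) * (u + lam).
  by rewrite ler_wpM2r //; slra.
slra.
Qed.

(** The overlap cut-off: [q + d] is the midpoint of [q] and 1, and the successor ensures
    [(q + d) * L <= r%:R]. *)
Let r := (Num.truncn ((q + d) * L)).+1.

(** The hypothesis gives t >= (1 - d)L, and 1 - d = q + d. *)
Lemma r_bounds : 2 * ln u - ln lam <= d * u ->
  (r <= M.+2)%N /\ (q + d) * L <= r%:R <= (q + d) * L + 1.
Proof.
move=> h; have sL0 : 0 <= (q + d) * L by rewrite mulr_ge0 ?addr_ge0 // ltW.
have /andP[r1 r2] := truncn_itv sL0.
rewrite /r -natr1 in r2 *; split; last by apply/andP; split; slra.
rewrite -(ler_nat R) -natr1 -[M.+2]addn2 natrD.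
have : (q + d) * L <= t.
  by rewrite /t /L mulrA ler_pM2r ?invr_gt0 //; rewrite /d in h *; lra.
slra.
Qed.

Lemma x_le : q * u ^+ 2 <= d / 2 * (lam * expR u) -> q ^+ M.+2 <= d / 2.
Proof.
move=> h; apply: (le_trans qMS_le).
by rewrite mulrA ler_pdivrMr ?mulr_gt0 // nu.
Qed.

(** Up to powers of [u], n x^2 q^(-r) is at most n^(q + d - 1) = n^(-d), and (M + 2)x is at most
    1/n; each of the two terms stays below 1/(2u). *)
Lemma pair_estimate :
    2 * ln u - ln lam <= d * u ->
    (4 * q / lam ^+ 2) * u ^+ 5 <= 2^-1 * expR (d * u) ->
    (4 * q / lam ^+ 2) * u ^+ 4 <= 2^-1 * expR u ->
  4 * (n%:R * (q ^+ M.+2) ^+ 2 * q ^- r) + 4 * (M.+2%:R * q ^+ M.+2) <= u^-1.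
Proof.
move=> h6 h8 h9; have [_ /andP[_ rle]] := r_bounds h6.
have x0 : 0 < q ^+ M.+2 by rewrite exprn_gt0.
set x := q ^+ M.+2 in x0 *.
have xle : x <= q * (u ^+ 2 / (lam * n%:R)) := qMS_le.
have qr : q ^- r <= expR ((q + d) * u) / q.
  have -> : q^-1 = expR lam by rewrite /q expRN invrK.
  rewrite qX expRN invrK -expRD ler_expR.
  apply: (@le_trans _ _ (lam * ((q + d) * L + 1))); first by rewrite ler_pM2l.
  by rewrite /L mulrDr mulr1 lerD2r le_eqVlt; apply/orP; left; apply/eqP; field; slra.
have nx : n%:R * x ^+ 2 <= n%:R * (q * (u ^+ 2 / (lam * n%:R))) ^+ 2.
  by rewrite ler_pM2l // lerXn2r // nnegrE ltW // (lt_le_trans x0).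
have T1 : 4 * (n%:R * x ^+ 2 * q ^- r) <= 2^-1 / u.
  apply: (@le_trans _ _ (4 * (n%:R * (q * (u ^+ 2 / (lam * n%:R))) ^+ 2 * (expR ((q + d) * u) / q)))).
    rewrite ler_pM2l // ler_pM //.
      by rewrite mulr_ge0 ?sqr_ge0 // ltW.
    by rewrite invr_ge0 exprn_ge0 // ltW.
  rewrite ler_pdivlMr //.
  have -> : expR ((q + d) * u) = n%:R / expR (d * u).
    by rewrite nu -expRN -expRD /d; congr expR; field.
  rewrite (_ : _ * u = (4 * q / lam ^+ 2 * u ^+ 5) / expR (d * u)).
    by rewrite ler_pdivrMr ?expR_gt0.
  by have := expR_gt0 (d * u); move=> ?; field; slra.
have T2 : 4 * (M.+2%:R * x) <= 2^-1 / u.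
  apply: (@le_trans _ _ (4 * (L * (q * (u ^+ 2 / (lam * n%:R)))))).
    by rewrite ler_pM2l // ler_pM ?MS_le // ltW.
  rewrite ler_pdivlMr // /L (_ : _ * u = (4 * q / lam ^+ 2 * u ^+ 4) / n%:R).
    by rewrite ler_pdivrMr // nu.
  by field; slra.
have -> : u^-1 = 2^-1 / u + 2^-1 / u by field; slra.
exact: lerD.
Qed.

(** The three exponents add up to L(1 + (q + d) ln L - (d/2)u), at most -lam L = -u. The decay comes
    from [q + d] in [E2] against [q + d / 2] in [E3]. *)
Lemma overlap_estimate :
    2 * ln u - ln lam <= d * u ->
    q * u ^+ 2 <= d / 2 * (lam * expR u) ->
    ln L <= u ->
    1 + (q + d) * ln L + lam <= d / 2 * u ->
  2 ^+ M.+2 * (M.+2%:R / n%:R) ^+ r * expR (n%:R * (q ^+ M.+2 / (1 - q ^+ M.+2)))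
  <= expR (- u).
Proof.
move=> h6 h5 hL h7; have [_ /andP[rge _]] := r_bounds h6.
have xd := x_le h5; have xle := qMS_le; set x := q ^+ M.+2 in xd xle *.
have x0 : 0 < x by rewrite exprn_gt0.
have E1 : 2 ^+ M.+2 <= expR L.
  apply: (@le_trans _ _ (expR (1 * M.+2%:R))); last by rewrite ler_expR mul1r MS_le.
  rewrite expRM_natr lerXn2r ?nnegrE ?expR_ge0 //.
  by have := expR_ge1Dx (1 : R); rewrite -natr1.
have E2 : (M.+2%:R / n%:R) ^+ r <= expR ((ln L - u) * ((q + d) * L)).
  apply: (@le_trans _ _ (expR ((ln L - u) * r%:R))).
    rewrite expRM_natr lerXn2r ?nnegrE ?expR_ge0 ?divr_ge0 ?(ltW n0) //.
    rewrite expRD expRN -nu lnK ?posrE // ler_pM2r ?invr_gt0 //; exact: MS_le.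
  by rewrite ler_expR ler_wnM2l // subr_le0.
have E3 : n%:R * (x / (1 - x)) <= u * L * (q + d / 2).
  apply: (@le_trans _ _ (n%:R * (x / q * (q + d / 2)))).
    rewrite ler_pM2l // ler_pdivrMr; last by rewrite /d in xd *; slra.
    (* As x <= d/2, dividing by 1 - x only raises the coefficient [q] to [q + d / 2]. *)
    have key : q <= (q + d / 2) * (1 - x).
      have : x * (q + d / 2) <= d / 2 * 1.
        by rewrite ler_pM ?(ltW x0) //; rewrite /d; slra.
      slra.
    apply: (@le_trans _ _ (x / q * q)); first by rewrite divfK ?gt_eqF.
    by rewrite -[leRHS]mulrA ler_pM2l ?divr_gt0.
  rewrite mulrA ler_pM2r; last by rewrite /d; slra.
  apply: (@le_trans _ _ (n%:R * (u ^+ 2 / (lam * n%:R)))).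
    by rewrite ler_pM2l // ler_pdivrMr // mulrC.
  by rewrite /L le_eqVlt; apply/orP; left; apply/eqP; field; slra.
apply: (@le_trans _ _ (expR L * expR ((ln L - u) * ((q + d) * L)) * expR (u * L * (q + d / 2)))).
  have p1 : 0 <= 2 ^+ M.+2 :> R by rewrite exprn_ge0.
  have p2 : 0 <= (M.+2%:R / n%:R) ^+ r :> R by rewrite exprn_ge0 // divr_ge0 // ltW.
  apply: ler_pM; [exact: mulr_ge0 | exact: expR_ge0 | exact: ler_pM | by rewrite ler_expR].
rewrite -!expRD ler_expR.
have : L * (1 + (q + d) * ln L + lam) <= L * (d / 2 * u) by rewrite ler_pM2l.
have -> : u = L * lam by rewrite /L divfK // gt_eqF.
slra.
Qed.

End Estimates.

(** * Asymptotics and the limit *)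

Local Open Scope classical_set_scope.
Local Open Scope ring_scope.

Section Asymptotics.
Variable R : realType.

Lemma near_pinfty_ge (a : R) : \forall u \near +oo, a <= u.
Proof. by apply: nbhs_pinfty_ge; apply: num_real. Qed.

(** The Taylor term of order [j.+1] of the exponential suffices: times [c] it is u^j (K u), and K u
    >= 1 eventually. *)
Lemma near_expX_le_expR (j : nat) (a c : R) : 0 < a -> 0 < c ->
  \forall u \near +oo, u ^+ j <= c * expR (a * u).
Proof.
move=> a0 c0; pose K : R := c * a ^+ j.+1 / j.+1`!%:R.
have K0 : 0 < K by rewrite divr_gt0 ?mulr_gt0 ?exprn_gt0 // ltr0n fact_gt0.
near=> u; have u1 : 1 <= u by near: u; apply: near_pinfty_ge.
have uK : K^-1 <= u by near: u; apply: near_pinfty_ge.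
have u0 : 0 < u by apply: lt_le_trans u1.
apply: (@le_trans _ _ (c * (1 + (a * u) ^+ j.+1 / j.+1`!%:R))); last first.
  by rewrite ler_pM2l // expR_ge1Dxn // mulr_ge0 // ltW.
apply: (@le_trans _ _ (c * ((a * u) ^+ j.+1 / j.+1`!%:R))); last first.
  by rewrite ler_pM2l // lerDr.
have -> : c * ((a * u) ^+ j.+1 / j.+1`!%:R) = u ^+ j * (K * u).
  by rewrite exprMn [u ^+ j.+1]exprS /K; ring.
by rewrite ler_peMr ?exprn_ge0 ?(ltW u0) // -ler_pdivrMl // mulr1.
Unshelve. all: by end_near. Qed.

(** Half of the slope [c] absorbs [ln u], the other half [b]. *)
Lemma near_ln_le (b c : R) : 0 < c -> \forall u \near +oo, ln u + b <= c * u.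
Proof.
move=> c0; have c20 : 0 < c / 2 by rewrite divr_gt0.
near=> u; have u1 : 1 <= u by near: u; apply: near_pinfty_ge.
have u0 : 0 < u by apply: lt_le_trans u1.
have h1 : ln u <= c / 2 * u.
  rewrite -[leRHS]expRK ler_ln ?posrE ?expR_gt0 // -[leRHS]mul1r -[leLHS]expr1.
  by near: u; apply: near_expX_le_expR.
have : b / (c / 2) <= u by near: u; apply: near_pinfty_ge.
rewrite ler_pdivrMr //; lra.
Unshelve. all: by end_near. Qed.

Lemma cvg_ln_nat : (ln n%:R : R) @[n --> \oo] --> +oo.
Proof.
apply/cvgryPge => A; near=> n.
have nA : expR A <= n%:R by near: n; apply: nbhs_infty_ger.
by rewrite -[A]expRK ler_ln ?posrE ?expR_gt0 // (lt_le_trans _ nA) ?expR_gt0.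
Unshelve. all: by end_near. Qed.

(** The three exponentials come from [dominating_estimate], [escape_estimate] and
    [overlap_estimate], the rest from [pair_estimate]. *)
Definition err (u : R) : R := 3 * expR (- u) + (expR u^-1 - 1).

Lemma cvg_err : err u @[u --> +oo] --> 0.
Proof.
rewrite (_ : 0 = 3 * 0 + (expR 0 - 1)); last by rewrite expR0 mulr0 subrr addr0.
apply: cvgD; first by apply: cvgMr; apply: cvgr_expR.
apply: cvgB; last exact: cvg_cst.
apply: (@cvg_comp _ _ _ (fun u : R => u^-1) expR _ (nbhs (0 : R))).
  apply/cvgrVy; first by near=> u; rewrite invr_gt0; near: u; apply: nbhs_pinfty_gt.
  rewrite (_ : unstable.inv_fun _ = id); last by apply/funext => u; apply: invrK.
  exact: cvg_id.
exact: continuous_expR.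
Unshelve. all: by end_near. Qed.

Variable p : R.
Hypothesis p01 : 0 < p < 1.
Let q := 1 - p.
Let lam := - ln q.
Let threshold (u : R) : R := (u - 2 * ln u + ln lam) / lam.

(** The limit is taken in the real variable [u], with [n] tied to it by [n%:R = expR u], so that all
    size conditions are comparisons of real functions at infinity. *)
Lemma near_Pr_not_concentrated_le : \forall u \near +oo, forall n : nat,
    n%:R = expR u ->
  0 <= threshold u /\
  Pr R 'I_n p (fun G => ~~ concentrated _ (Num.truncn (threshold u)) G) <= err u.
Proof.
have [q0 q1] : 0 < q /\ q < 1 by case/andP: p01 => *; rewrite /q; split; lra.
have lam0 : 0 < lam by rewrite /lam oppr_gt0 ln_lt0 // q0.
have qE : q = expR (- lam) by rewrite /lam opprK lnK.
pose d := (1 - q) / 2.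
have d0 : 0 < d by rewrite /d; lra.
have d1 : d <= 2^-1 by rewrite /d; lra.
have d2 : d / 2 <= 2^-1 by lra.
have s0 : 0 < q + d by lra.
(* [C] is the value at u = 1 of the left side of [hc], which is therefore at most C u^2 for u >=
   1. *)
pose C := (2 / lam + 1) * (1 + lam) + 1.
have C0 : 0 < C.
  have : 0 < (2 / lam + 1) * (1 + lam) by rewrite mulr_gt0 ?addr_gt0 ?divr_gt0.
  by rewrite /C; lra.
have lamq0 : 0 < lam ^+ 2 / (8 * q) by rewrite divr_gt0 ?exprn_gt0 ?mulr_gt0.
near=> u => n nu.
have u1 : 1 <= u by near: u; apply: near_pinfty_ge.
have u0 : 0 < u by apply: lt_le_trans u1.
have lnu_ge : 2 * lam <= 2 * ln u - ln lam.
  have : expR (lam + ln lam / 2) <= u by near: u; apply: near_pinfty_ge.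
  by rewrite -ler_ln ?posrE ?expR_gt0 // expRK; lra.
have h6 : 2 * ln u - ln lam <= d * u.
  have : ln u + - ln lam / 2 <= d / 2 * u.
    by near: u; apply: near_ln_le; rewrite divr_gt0.
  lra.
have h2 : u ^+ 2 <= lam ^+ 2 * expR u.
  by rewrite -[u in expR u]mul1r; near: u; apply: near_expX_le_expR; rewrite ?exprn_gt0.
have hc : (2 * (u / lam) + 1) * (u + lam) + u <= lam * expR u.
  have hu : u ^+ 2 <= lam / C * expR (1 * u).
    by near: u; apply: near_expX_le_expR; rewrite // divr_gt0.
  apply: (@le_trans _ _ (C * u ^+ 2)); last first.
    by rewrite -ler_pdivlMl // mulrA [C^-1 * _]mulrC -[u in expR u]mul1r.
  have uu : u <= u ^+ 2 by rewrite expr2 ler_peMr // ltW.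
  have lu : lam * 1 <= lam * u ^+ 2 by rewrite ler_pM2l // (le_trans u1).
  have -> : C * u ^+ 2 = 2 / lam * u ^+ 2 + 4 * u ^+ 2 + lam * u ^+ 2.
    by rewrite /C; field; lra.
  have -> : (2 * (u / lam) + 1) * (u + lam) + u = 2 / lam * u ^+ 2 + 4 * u + lam.
    by field; lra.
  lra.
have h5 : q * u ^+ 2 <= d / 2 * (lam * expR u).
  have : u ^+ 2 <= d / 2 * lam / q * expR (1 * u).
    by near: u; apply: near_expX_le_expR; rewrite // divr_gt0 // mulr_gt0 // divr_gt0.
  rewrite mul1r -(ler_pM2l q0) => /le_trans; apply.
  by rewrite le_eqVlt; apply/orP; left; apply/eqP; field; lra.
have h8 : (4 * q / lam ^+ 2) * u ^+ 5 <= 2^-1 * expR (d * u).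
  have -> : 4 * q / lam ^+ 2 = 2^-1 / (lam ^+ 2 / (8 * q)) by field; lra.
  rewrite -mulrA ler_pM2l // ler_pdivrMl //.
  by near: u; apply: near_expX_le_expR.
have h9 : (4 * q / lam ^+ 2) * u ^+ 4 <= 2^-1 * expR u.
  have -> : 4 * q / lam ^+ 2 = 2^-1 / (lam ^+ 2 / (8 * q)) by field; lra.
  rewrite -mulrA ler_pM2l // ler_pdivrMl // -[u in expR u]mul1r.
  by near: u; apply: near_expX_le_expR.
have lnL : ln (u / lam) = ln u - ln lam by rewrite ln_div.
have hL : ln (u / lam) <= u.
  by rewrite lnL -[leRHS]mul1r; near: u; apply: near_ln_le.
have h7 : 1 + (q + d) * ln (u / lam) + lam <= d / 2 * u.
  have : ln u + ((1 + lam) / (q + d) - ln lam) <= d / 2 / (q + d) * u.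
    by near: u; apply: near_ln_le; rewrite divr_gt0 // divr_gt0.
  rewrite -(ler_pM2l s0) lnL.
  have -> : (q + d) * (d / 2 / (q + d) * u) = d / 2 * u by field; lra.
  have -> : (q + d) * (ln u + ((1 + lam) / (q + d) - ln lam)) =
    1 + (q + d) * (ln u - ln lam) + lam by field; lra.
  by [].
have t0 : 0 <= threshold u.
  rewrite /threshold divr_ge0 ?(ltW lam0) //.
  have : d * u <= 1 * u by rewrite ler_pM2r //; lra.
  lra.
split => //; have /andP[Mt tM] := truncn_itv t0; rewrite -natr1 in tM.
set M := Num.truncn _ in Mt tM *.
pose r := (Num.truncn ((expR (- lam) + (1 - expR (- lam)) / 2) * (u / lam))).+1.
have dE : d = (1 - expR (- lam)) / 2 by rewrite -qE.
(* The estimates are stated with [expR (- lam)] in place of [q]. *)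
move: d2 h5 h6 h7 h8 h9; rewrite dE qE => d2 h5 h6 h7 h8 h9.
have [Kn Ec] := escape_estimate R lam u n M lam0 u1 nu Mt tM lnu_ge hc.
have Mn : (M <= n)%N by move: Kn; clear; lia.
have Ea := dominating_estimate R lam u n M lam0 u1 nu Mt tM lnu_ge h2 Mn.
have [rM _] := r_bounds R lam u n M lam0 u1 nu Mt tM lnu_ge h6.
have xd := x_le R lam u n M lam0 u1 nu Mt tM lnu_ge h5.
have Ep := pair_estimate R lam u n M lam0 u1 nu Mt tM lnu_ge h6 h8 h9.
have Eo := overlap_estimate R lam u n M lam0 u1 nu Mt tM lnu_ge h6 h5 hL h7.
have := Pr_not_concentrated_le R 'I_n p p01 M r.
rewrite card_ord -/q qE => /(_ (ltnW Kn)) H.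
apply: le_trans (H _ rM) _.
  exact: le_trans xd d2.
have -> : err u = expR (- u) + expR (- u) + ((expR u^-1 - 1) + expR (- u)).
  by rewrite /err; ring.
apply: lerD; first exact: lerD Ea Ec.
by apply: lerD Eo; rewrite lerD2r ler_expR; exact: Ep.
Unshelve. all: by end_near. Qed.

End Asymptotics.

Theorem theorem14 (R : realType) (p : R) (hp : 0 < p < 1) :
  let q : R := 1 - p in
  let log : R -> R := logb (1 / q) in
  let m (n : nat) : int :=
    Num.floor (log n%:R - 2 * log (log n%:R) + log (log (expR 1))) in
  gnp_prob p (fun G : sgraph 'I_n =>
    [&& gamma_r G == gamma G,
        [exists X, total_dominating G X],
        [exists X, total_restrained_dominating G X],
        gamma_tr G == gamma_t G
      & ((gamma_r G)%:Z == m n + 1) || ((gamma_r G)%:Z == m n + 2)])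
    @[n --> \oo] --> (1 : R).
Proof.
move=> q log m.
have [q0 q1] : 0 < q /\ q < 1 by case/andP: hp => *; rewrite /q; split; lra.
have lam0 : 0 < - ln q by rewrite oppr_gt0 ln_lt0 // q0.
have logE x : log x = ln x / - ln q by rewrite /log /logb mul1r lnV.
have errn : (1 - err R (ln n%:R)) @[n --> \oo] --> (1 : R).
  rewrite -[X in _ --> X]subr0; apply: cvgB; first exact: cvg_cst.
  exact: cvg_comp (cvg_ln_nat R) (cvg_err R).
(* The probability is squeezed between [1 - err R (ln n%:R)] and 1. *)
apply: (squeeze_cvgr _ errn (cvg_cst _)).
have ev := cvg_ln_nat R _ (near_Pr_not_concentrated_le R p hp).
near=> n.
have n0 : (0 < n)%N by near: n; exists 1%N.
have nE : n%:R = expR (ln n%:R) :> R by rewrite lnK // posrE ltr0n.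
have u1 : 1 <= ln n%:R :> R.
  by near: n; exact: cvg_ln_nat R _ (near_pinfty_ge R 1).
have u0 : 0 < ln n%:R :> R by apply: lt_le_trans u1.
have : forall k : nat, k%:R = expR (ln n%:R) :> R ->
  0 <= (ln n%:R - 2 * ln (ln n%:R) + ln (- ln q)) / - ln q /\
  Pr R 'I_k p (fun G => ~~ concentrated _
    (Num.truncn ((ln n%:R - 2 * ln (ln n%:R) + ln (- ln q)) / - ln q)) G)
  <= err R (ln n%:R).
  by near: n; exact: ev.
move=> /(_ n nE) []; set t := (_ / - ln q) => t0 Prn.
(* With u = ln n, log log n = (ln u - ln lam)/lam and log log e = -(ln lam)/lam, so the argument of
   the floor is [t]; truncation agrees with the floor as [t] is nonnegative. *)
have mE : m n = (Num.truncn t)%:Z.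
  rewrite /m (_ : _ + _ = t); last first.
    rewrite !logE expRK mul1r ln_div ?posrE // lnV ?posrE // /t; field.
    by rewrite lt_eqF // -oppr_gt0.
  by rewrite truncn_floor t0 gez0_abs // floor_ge0.
rewrite -[gnp_prob p _]/(Pr R 'I_n p _).
rewrite (eq_Pr _ _ _ _ (concentrated _ (Num.truncn t))); last first.
  move=> G; rewrite /concentrated mE; do 4! congr (_ && _).
  by rewrite -!PoszD !eqz_nat addn1 addn2.
apply/andP; split; last exact: Pr_le1.
by rewrite PrC // lerD2l lerN2.
Unshelve. all: by end_near. Qed.
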